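(* Let $m>0$ and $k>m$ be real numbers. If $\beta=1$, $a=1$, $b=k-m$ and $c=1$, then $\mathcal{GNB\text{-}BE}(m,\beta,a,b,c)$ reduces to the Waring distribution; that is, the probability mass function of $X\sim\mathcal{GNB\text{-}BE}(m,1,1,k-m,1)$ is $$h_3(x)=\frac{(k-m)\,\Gamma(m+x)\,\Gamma(k)}{\Gamma(m)\,\Gamma(k+x+1)},\qquad x=0,1,2,\dots$$
   Context: For $r,s>0$, $B(r,s)=\frac{\Gamma(r)\Gamma(s)}{\Gamma(r+s)}$. For real $y$ and integer $x\ge 0$, $\binom{y}{x}=\frac{y(y-1)\cdots(y-x+1)}{x!}$. The generalized negative binomial distribution $\mathcal{GNB}(m,\beta,\theta)$ has probability mass function $\frac{m}{m+\beta x}\binom{m+\beta x}{x}(1-\theta)^{x}\theta^{m+\beta x-x}$, $x=0,1,2,\dots$. The beta exponential distribution $\mathcal{BE}(a,b,c)$, $a,b,c>0$, has density $g(\lambda;a,b,c)=\frac{c}{B(a,b)}e^{-bc\lambda}(1-e^{-c\lambda})^{a-1}$ for $\lambda>0$. The distribution $\mathcal{GNB\text{-}BE}(m,\beta,a,b,c)$ is the mixture defined by $X\mid\lambda\sim\mathcal{GNB}(m,\beta,\theta=e^{-\lambda})$, $\lambda\sim\mathcal{BE}(a,b,c)$: its mass function is $$p(x)=\int_0^\infty \frac{m}{m+\beta x}\binom{m+\beta x}{x}(1-e^{-\lambda})^{x}e^{-\lambda(m+\beta x-x)}\,g(\lambda;a,b,c)\,d\lambda,\qquad x=0,1,2,\dots$$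 The Waring distribution is the distribution with the mass function $h_3$ displayed in the claim. *)

(* Defs.v *)
From mathcomp Require Import all_boot all_order all_algebra.
From mathcomp Require Import all_classical all_reals all_analysis.

Set Implicit Arguments.
Unset Strict Implicit.
Unset Printing Implicit Defensive.

Import Order.TTheory GRing.Theory Num.Theory.
Import numFieldNormedType.Exports.

Local Open Scope classical_set_scope.
Local Open Scope ring_scope.

(* Euler's integral: the real-valued integral is meaningful for 0 < s, where
   the integrand is integrable; for other s, Gamma s is a junk value. *)
Definition Gamma (R : realType) (s : R) : R :=
  \int[@lebesgue_measure R]_(t in `]0, +oo[) (t `^ (s - 1) * expR (- t)).

(* The library's beta_fun only takes natural-number arguments. *)
Definition Beta (R : realType) (r s : R) : R :=
  Gamma r * Gamma s / Gamma (r + s).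

(* y (y - 1) ... (y - x + 1) / x! *)
Definition gbinom (R : realType) (y : R) (x : nat) : R :=
  (\prod_(i < x) (y - i%:R)) / x`!%:R.

(* The last exponent is real, hence powR. *)
Definition gnb_pmf (R : realType) (m beta theta : R) (x : nat) : R :=
  m / (m + beta * x%:R) * gbinom (m + beta * x%:R) x *
  (1 - theta) ^+ x * theta `^ (m + beta * x%:R - x%:R).

(* Density on ]0, +oo[ only: the formula is not extended by 0 to l <= 0. *)
Definition be_pdf (R : realType) (a b c l : R) : R :=
  c / Beta a b * expR (- (b * c * l)) * (1 - expR (- (c * l))) `^ (a - 1).

(* Mixture of GNB(m, beta, exp(-l)) over l with the beta exponential density.
   The value is an extended real, so that an equation with a finite number
   includes the convergence of the integral. *)
Definition gnb_be_pmf (R : realType) (m beta a b c : R) (x : nat) : \bar R :=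
  (\int[@lebesgue_measure R]_(l in `]0%R, +oo[)
    (gnb_pmf m beta (expR (- l)) x * be_pdf a b c l)%:E)%E.

Definition waring_pmf (R : realType) (m k : R) (x : nat) : R :=
  (k - m) * Gamma (m + x%:R) * Gamma k / (Gamma m * Gamma (k + x%:R + 1)).

(* Main.v *)
Require Import Defs.
From mathcomp Require Import all_boot all_order all_algebra.
From mathcomp Require Import all_classical all_reals all_analysis.
From mathcomp Require Import measurable_realfun.
From mathcomp Require Import ring lra.
Import Order.TTheory GRing.Theory Num.Theory.
Import numFieldNormedType.Exports.
Local Open Scope ring_scope.

(** When beta = a = c = 1 and b = k - m, the powers of exp(-l) coming from
    the negative binomial weight and from the density combine to exp(-k l), so
    the mixture is a constant times the integral over l > 0 of
    exp(-k l) (1 - exp(-l))^x.  This is the beta integral B(k, x + 1) after the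
    substitution u = exp(-l).  Its value x! / (k (k + 1) ... (k + x)) is
    obtained without substituting, by induction on x ([integral_expRN_onem]).
    In the constant, the generalized binomial coefficient times m / (m + x) is
    the rising factorial m (m + 1) ... (m + x - 1) divided by x!
    ([gbinom_rising]), and 1 / B(1, k - m) is k - m ([Beta1]).

    There remain the ratios of values of Gamma in the Waring mass function:
    they are rising factorials, by the functional equation
    Gamma (s + 1) = s Gamma s ([GammaD1]), together with Gamma s > 0
    ([Gamma_gt0]) to cancel.  The functional equation is proved first for
    Euler's integral as an extended real: integration by parts on compact
    intervals [1/(n+2), n+2] avoids the singularity at 0, the boundary terms
    vanish in the limit, and both integrals converge by monotone convergence
    whether or not they are finite ([euler_integralD1]).  Finiteness then
    follows from the functional equation: it gives the value at every positive
    integer, t^(s-1) is at most 1 + t^N for s >= 1 and N >= s - 1, and s < 1 is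
    reached from s + 1. *)

(** * Rising factorials *)

(** Both sides are y (y + 1) ... (y + n): the falling factorial of y + n is
    the rising factorial of y + 1 read backwards. *)
Lemma mul_prod_falling (R : comPzRingType) (y : R) n :
  y * \prod_(i < n) (y + n%:R - i%:R) = (y + n%:R) * \prod_(i < n) (y + i%:R).
Proof.
transitivity (\prod_(i < n.+1) (y + i%:R)); last by rewrite big_ord_recr mulrC.
rewrite big_ord_recl addr0; congr (_ * _).
(* factor i + 1 on the left is matched with the i-th factor from the end *)
rewrite [RHS](reindex_inj rev_ord_inj)/=; apply: eq_bigr => i _.
by rewrite /bump /= add1n subnSK// natrB ?(ltnW (ltn_ord i))// addrA.
Qed.

Lemma prod_rising_recl (R : pzRingType) (y : R) n :
  \prod_(i < n.+1) (y + i%:R) = y * \prod_(i < n) (y + 1 + i%:R).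
Proof.
rewrite big_ord_recl addr0; congr (_ * _); apply: eq_bigr => i _.
by rewrite -[LHS]/(y + i.+1%:R) -natr1 addrAC addrA.
Qed.

Lemma prod_rising_gt0 (R : numDomainType) (y : R) n : 0 < y ->
  0 < \prod_(i < n) (y + i%:R).
Proof. by move=> y0; apply: prodr_gt0 => i _; rewrite ltr_wpDr. Qed.

(** The coefficient of the negative binomial distribution (beta = 1). *)
Lemma gbinom_rising (R : realType) (m : R) n : 0 < m ->
  m / (m + n%:R) * gbinom (m + n%:R) n = \prod_(i < n) (m + i%:R) / n`!%:R.
Proof.
move=> m0; rewrite /gbinom mulrA [m / _ * _]mulrAC mul_prod_falling.
congr (_ / _).
by rewrite mulrAC mulfV ?mul1r// gt_eqF// ltr_wpDr.
Qed.

Section gamma_and_beta_integrals.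
Local Open Scope classical_set_scope.
Context {R : realType}.
Local Notation mu := (@lebesgue_measure R).
Implicit Types (s k t : R).

(** * The integral of exp(-k t) *)

Lemma measurable_expRN_scale k (D : set R) :
  measurable_fun D (fun t : R => expR (- (k * t))).
Proof.
apply: measurable_funTS; apply: measurableT_comp => //.
exact: measurableT_comp.
Qed.

Lemma integral_expRN k : 0 < k ->
  (\int[mu]_(t in `]0%R, +oo[) (expR (- (k * t)))%:E = (k^-1)%:E)%E.
Proof.
move=> k0.
have cexp : continuous (fun t : R => expR (- (k * t))).
  move=> z; apply: continuous_comp; last exact: continuous_expR.
  by apply: continuousN; apply: continuousM => //; exact: cst_continuous.
rewrite integral_itv_obnd_cbnd; last first.
  by apply/measurable_EFinP; exact: measurable_expRN_scale.
rewrite (@ge0_continuous_FTC2y _ _ (fun t => - k^-1 * expR (- (k * t))) _ 0)//.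
- by rewrite mulr0 oppr0 expR0 mulr1 EFinN oppeK add0e.
- exact: continuous_subspaceT.
- rewrite -[X in _ --> X](mulr0 (- k^-1)); apply: cvgMl_tmp.
  apply: (@cvg_comp _ _ _ ( *%R k) (fun z => expR (- z)) _ (pinfty_nbhs R)).
    exact: gt0_cvgMry.
  exact: cvgr_expR.
- by apply: cvg_at_right_filter; apply: cvgMl_tmp; exact: cexp.
- move=> t _; rewrite derive1E derive_val /GRing.scale/=.
  by field; exact: lt0r_neq0.
Qed.

(** * The functional equation of Euler's integral *)

Lemma continuous_powR s (a : R) : 0 < a ->
  {for a, continuous (fun t : R => t `^ s)}.
Proof.
move=> a0; apply: differentiable_continuous; apply/derivable1_diffP.
by apply: derivable_powR; rewrite in_itv/= a0.
Qed.

Lemma continuous_expRN : continuous (fun t : R => expR (- t)).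
Proof.
move=> t; apply: continuous_comp; last exact: continuous_expR.
exact: opp_continuous.
Qed.

Lemma measurable_powR_expRN (r : R) (D : set R) :
  measurable_fun D (fun t : R => t `^ r * expR (- t)).
Proof.
apply: measurable_funTS; apply: measurable_funM; first exact: measurable_powR.
by apply: measurableT_comp => //; exact: measurable_oppr.
Qed.

Lemma powR_expRN_ge0 (r t : R) : 0 <= t `^ r * expR (- t).
Proof. by rewrite mulr_ge0 ?powR_ge0 ?expR_ge0. Qed.

(** Stated with a sum rather than a difference of integrals, so that it passes
    to the limit even if the limits are infinite. *)
Lemma integral_powR_expRN_parts s (a b : R) : 0 < s -> 0 < a -> a < b ->
  (\int[mu]_(t in `[a, b]) (t `^ s * expR (- t))%:E =
   (a `^ s * expR (- a) - b `^ s * expR (- b))%:E +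
   s%:E * \int[mu]_(t in `[a, b]) (t `^ (s - 1) * expR (- t))%:E)%E.
Proof.
move=> s0 a0 ab.
have b0 : 0 < b by exact: lt_trans ab.
have pos t : t \in `[a, b]%R -> 0 < t.
  by rewrite in_itv/= => /andP[+ _]; exact: lt_le_trans.
have cpow r : {within `[a, b], continuous (fun t : R => t `^ r)}.
  apply: continuous_in_subspaceT => t; rewrite inE => tab.
  exact: continuous_powR (pos _ tab).
rewrite (@integration_by_parts _ (fun t => t `^ s) (fun t => - expR (- t))
   (fun t => s * t `^ (s - 1)) (fun t => expR (- t)))//.
- rewrite -ge0_integralZl_EFin ?(ltW s0)//=; last 2 first.
  + by move=> t _; rewrite lee_fin powR_expRN_ge0.
  + by apply/measurable_EFinP; exact: measurable_powR_expRN.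
  rewrite -[X in _ = (_ + X)%E]oppeK -[in RHS]integral_ge0N; last first.
    by move=> t _; rewrite -EFinM lee_fin mulr_ge0 ?powR_expRN_ge0// ltW.
  congr (_ - _)%E; first by congr EFin; ring.
  by apply: eq_integral => t _; rewrite -EFinM -EFinN; congr EFin; ring.
- by move=> t; apply: cvgMl_tmp; exact: cpow.
- split => [t|/=|/=].
  + rewrite in_itv/= => /andP[at_ _]; apply: derivable_powR.
    by rewrite in_itv/= andbT (lt_trans a0).
  + by apply: cvg_at_right_filter; exact: continuous_powR.
  + by apply: cvg_at_left_filter; exact: continuous_powR.
- move=> t; rewrite in_itv/= => /andP[at_ _]; apply: powR_derive1.
  by rewrite in_itv/= andbT (lt_trans a0).
- exact/continuous_subspaceT/continuous_expRN.
- split => [t _|/=|/=].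
  + exact: ex_derive.
  + by apply: cvg_at_right_filter; apply: cvgN; exact: continuous_expRN.
  + by apply: cvg_at_left_filter; apply: cvgN; exact: continuous_expRN.
- by move=> t _; rewrite derive1E derive_val mulrN1 opprK.
Qed.

(** The extended-real value of Euler's integral, so that equations between
    such values make sense before the integrand is known to be integrable. *)
Definition euler_integral (s : R) : \bar R :=
  (\int[mu]_(t in `]0%R, +oo[) (t `^ (s - 1) * expR (- t))%:E)%E.

Lemma Gamma_fine s : Gamma s = fine (euler_integral s).
Proof. by []. Qed.

Lemma itv0y_bigcup :
  `]0 : R, +oo[ = \bigcup_n `[(n.+2%:R)^-1 : R, n.+2%:R].
Proof.
apply/seteqP; split => [t|t [n _]] /=; rewrite !in_itv/= ?andbT.
  (* t + 1/t bounds both t and 1/t *)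
  move=> t0; exists (Num.truncn (t + t^-1)) => //=; rewrite in_itv/=.
  have tt : t + t^-1 <= (Num.truncn (t + t^-1)).+2%:R.
    by apply/ltW/(lt_trans (truncnS_gt _)); rewrite ltr_nat.
  apply/andP; split.
    rewrite -[leRHS]invrK lef_pV2 ?posrE ?invr_gt0//.
    by apply: le_trans tt; rewrite lerDr ltW.
  by apply: le_trans tt; rewrite lerDl invr_ge0 ltW.
by move=> /andP[+ _]; apply: lt_le_trans; rewrite invr_gt0.
Qed.

Lemma cvg_exhaustion (f : R -> R) : measurable_fun [set: R] f ->
  (forall t, 0 < t -> 0 <= f t) ->
  (\int[mu]_(t in `[(n.+2%:R)^-1%R, n.+2%:R%R]) (f t)%:E @[n --> \oo] -->
   \int[mu]_(t in `]0%R, +oo[) (f t)%:E)%E.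
Proof.
move=> mf f0; rewrite itv0y_bigcup; apply: ge0_nondecreasing_set_cvg_integral.
- apply/nondecreasing_seqP => n; rewrite subsetEset; apply: subset_itv.
    by rewrite bnd_simp lef_pV2 ?posrE// ler_nat.
  by rewrite bnd_simp ler_nat.
- by move=> n.
- by move=> n; apply/measurable_EFinP; exact: measurable_funTS.
- move=> n t /=; rewrite in_itv/= lee_fin => /andP[nt _]; apply: f0.
  by apply: lt_le_trans nt; rewrite invr_gt0.
Qed.

Lemma cvg_invn2 : ((n.+2%:R : R)^-1 @[n --> \oo] --> (0 : R)).
Proof. by have := @cvg_harmonic R; rewrite -cvg_shiftS. Qed.

(** For a natural number N >= s, b^s is at most b^N, while exp b is at least
    the term b^(N+1) / (N+1)! of its series. *)
Lemma powR_expRN_le (s b : R) : 1 <= b ->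
  b `^ s * expR (- b) <= ((Num.truncn s).+2)`!%:R * b^-1.
Proof.
move=> b1; have b0 : 0 < b by exact: lt_le_trans b1.
set N := (Num.truncn s).+1.
rewrite expRN -[leLHS]mulrC ler_pdivrMl ?expR_gt0//.
apply: (@le_trans _ _ (b ^+ N)).
  rewrite -powR_mulrn; last exact: ltW.
  by apply: ler_powR => //; exact/ltW/truncnS_gt.
have -> : b ^+ N = b ^+ N.+1 / (N.+1)`!%:R * ((N.+1)`!%:R / b).
  by rewrite exprSr; field; rewrite gt_eqF//= pnatr_eq0 -lt0n fact_gt0.
rewrite ler_wpM2r//; first by rewrite divr_ge0// ltW.
by apply: le_trans (expR_ge1Dxn N (ltW b0)); rewrite lerDr.
Qed.

Lemma cvg_powR_expRNy s :
  ((n.+2%:R : R) `^ s * expR (- n.+2%:R) @[n --> \oo] --> (0 : R)).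
Proof.
pose C : R := ((Num.truncn s).+2)`!%:R.
apply: (@squeeze_cvgr _ _ _ _ (cst 0) (fun n => C * (n.+2%:R)^-1)).
- near=> n; rewrite powR_expRN_ge0/=.
  by rewrite powR_expRN_le// ler1n.
- exact: cvg_cst.
- by rewrite -[X in _ --> X](mulr0 C); apply: cvgMl_tmp; exact: cvg_invn2.
Unshelve. all: by end_near. Qed.

Lemma cvg_powR_expRN0 s : 0 < s ->
  ((n.+2%:R : R)^-1 `^ s * expR (- (n.+2%:R)^-1) @[n --> \oo] --> (0 : R)).
Proof.
move=> s0; rewrite -[X in _ --> X](mul0r (expR (- 0))); apply: cvgM.
  apply: (cvg_at_rightP _ _ _).1 (powR_cvg0 s0) _ _.
  by split; [move=> n; rewrite invr_gt0|exact: cvg_invn2].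
apply: (@cvg_comp _ _ _ (fun n => (n.+2%:R : R)^-1) (fun z => expR (- z)) _
  (nbhs (0 : R))).
  exact: cvg_invn2.
exact: continuous_expRN.
Qed.

(** Integration by parts on [1/(n+2), n+2], in the limit; the values may be
    infinite at this stage. *)
Lemma euler_integralD1 s : 0 < s ->
  euler_integral (s + 1) = (s%:E * euler_integral s)%E.
Proof.
move=> s0; rewrite /euler_integral addrK.
have exhaust r := cvg_exhaustion _ (measurable_powR_expRN r _)
  (fun t _ => powR_expRN_ge0 r t).
have L := exhaust s; have := exhaust (s - 1).
move=> /(cvgeZl (isT : s%:E \is a fin_num)) L'.
have B : ((n.+2%:R^-1 `^ s * expR (- n.+2%:R^-1) -
           n.+2%:R `^ s * expR (- n.+2%:R) : R)%:E @[n --> \oo] --> 0%E).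
  apply: cvg_EFin; first exact: nearW.
  rewrite -[X in _ --> X](subr0 (0 : R)).
  by apply: cvgB; [exact: cvg_powR_expRN0|exact: cvg_powR_expRNy].
have := cvgeD (fin_num_adde_defr _ (isT : 0%E \is a fin_num)) B L'.
rewrite add0e => /(_ eventually_filter) H.
rewrite -[LHS](cvg_lim _ L)// -[RHS](cvg_lim _ H)//; apply: congr_lim.
apply/funext => n /=.
apply: integral_powR_expRN_parts => //.
by rewrite (@lt_trans _ _ 1) ?invf_lt1 ?ltr1n.
Qed.

(** * Finiteness and positivity of Euler's integral *)

Lemma euler_integral_ge0 s : (0 <= euler_integral s)%E.
Proof.
by apply: integral_ge0 => t _; rewrite lee_fin powR_expRN_ge0.
Qed.

Lemma euler_integral1 : euler_integral 1 = 1%E.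
Proof.
have := @integral_expRN 1 ltr01; rewrite invr1 => <-.
by apply: eq_integral => t _; rewrite subrr powRr0 !mul1r.
Qed.

Lemma euler_integral_nat n : euler_integral n.+1%:R \is a fin_num.
Proof.
elim: n => [|n IHn]; first by rewrite euler_integral1.
by rewrite -natr1 euler_integralD1 ?ltr0n// fin_numM.
Qed.

(** For s >= 1, t^(s-1) is at most 1 when t <= 1 and at most t^N when t >= 1,
    with N the integer part of s; hence the integral is at most the sum of its
    values at 1 and N + 1. *)
Lemma euler_integral_fin_num s : 0 < s -> euler_integral s \is a fin_num.
Proof.
wlog s1 : s / 1 <= s => [wlg s0|_].
  have := wlg (s + 1); rewrite lerDr (ltW s0) euler_integralD1//.
  move=> /(_ isT) /(_ (addr_gt0 s0 ltr01)).
  rewrite !ge0_fin_numE ?mule_ge0 ?euler_integral_ge0 ?lee_fin ?(ltW s0)//.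
  apply: contraTT; rewrite -!leNgt !leye_eq => /eqP ->.
  by rewrite gt0_muley ?lte_fin.
rewrite ge0_fin_numE ?euler_integral_ge0//.
set N := Num.truncn s.
have : (euler_integral 1 + euler_integral N.+1%:R < +oo)%E.
  by apply: lte_add_pinfty; rewrite -ge0_fin_numE ?euler_integral_ge0//;
    [rewrite euler_integral1|exact: euler_integral_nat].
apply: le_lt_trans.
rewrite -ge0_integralD//; first last.
- by apply/measurable_EFinP; exact: measurable_powR_expRN.
- by move=> t _; rewrite lee_fin powR_expRN_ge0.
- by apply/measurable_EFinP; exact: measurable_powR_expRN.
- by move=> t _; rewrite lee_fin powR_expRN_ge0.
apply: ge0_le_integral => //.
- by move=> t _; rewrite lee_fin powR_expRN_ge0.
- by apply/measurable_EFinP; exact: measurable_powR_expRN.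
- by apply: emeasurable_funD; apply/measurable_EFinP;
    exact: measurable_powR_expRN.
move=> t /=; rewrite in_itv/= andbT => t0.
rewrite -EFinD lee_fin -mulrDl ler_wpM2r ?expR_ge0// subrr powRr0.
have [t1|/ltW t1] := leP t 1.
  rewrite (@le_trans _ _ 1) ?lerDl ?powR_ge0//.
  by rewrite -[leRHS](powRr0 t); apply: ger_powR; rewrite ?t0//= subr_ge0.
rewrite (@le_trans _ _ (t `^ (N.+1%:R - 1))) ?lerDr//.
by apply: ler_powR => //; rewrite lerD2r; exact/ltW/truncnS_gt.
Qed.

(** For s >= 1, the integrand is at least exp(-2) on [1, 2]. *)
Lemma euler_integral_gt0 s : 0 < s -> (0 < euler_integral s)%E.
Proof.
wlog s1 : s / 1 <= s => [wlg s0|_].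
  have := wlg (s + 1); rewrite lerDr (ltW s0) euler_integralD1//.
  move=> /(_ isT) /(_ (addr_gt0 s0 ltr01)).
  by rewrite pmule_rgt0.
have : (0 < \int[mu]_(t in `[1%R, 2%R]) (expR (- 2))%:E)%E.
  rewrite integral_cst//= lebesgue_measure_itv/= lte_fin ltr1n.
  rewrite -EFinB -EFinM lte_fin.
  by rewrite mulr_gt0 ?expR_gt0//; lra.
move=> /lt_le_trans; apply.
apply: (@le_trans _ _
  (\int[mu]_(t in `[1%R, 2%R]) (t `^ (s - 1) * expR (- t))%:E)%E).
  apply: ge0_le_integral => //.
  - by apply/measurable_EFinP; exact: measurable_powR_expRN.
  move=> t /=; rewrite in_itv/= lee_fin => /andP[t1 t2].
  rewrite -[leLHS]mul1r ler_pM ?expR_ge0//.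
    by rewrite -[leLHS](powRr0 t) ler_powR// subr_ge0.
  by rewrite ler_expR lerN2.
apply: ge0_subset_integral => //=.
- by apply/measurable_EFinP; exact: measurable_powR_expRN.
- by move=> t _; rewrite lee_fin powR_expRN_ge0.
- by move=> t /=; rewrite !in_itv/= andbT => /andP[+ _]; exact: lt_le_trans.
Qed.

(** * The Gamma function *)

Lemma Gamma_gt0 s : 0 < s -> 0 < Gamma s.
Proof.
move=> s0; rewrite Gamma_fine fine_gt0// euler_integral_gt0//=.
by rewrite ltey_eq euler_integral_fin_num.
Qed.

Lemma GammaD1 s : 0 < s -> Gamma (s + 1) = s * Gamma s.
Proof.
move=> s0.
by rewrite !Gamma_fine euler_integralD1// fineM ?euler_integral_fin_num.
Qed.

Lemma Gamma1 : Gamma (1 : R) = 1.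
Proof. by rewrite Gamma_fine euler_integral1. Qed.

Lemma Gamma_addn s n : 0 < s ->
  Gamma (s + n%:R) = \prod_(i < n) (s + i%:R) * Gamma s.
Proof.
move=> s0; elim: n => [|n IHn]; first by rewrite addr0 big_ord0 mul1r.
rewrite -natr1 addrA GammaD1 ?ltr_wpDr// IHn big_ord_recr/=.
by ring.
Qed.

Lemma Beta1 (b : R) : 0 < b -> Beta 1 b = b^-1.
Proof.
move=> b0; rewrite /Beta Gamma1 mul1r addrC GammaD1//.
by rewrite invfM mulrCA mulfV ?mulr1// gt_eqF// Gamma_gt0.
Qed.

(** * The beta integral in exponential form *)

Lemma measurable_expRN_onem k n (D : set R) :
  measurable_fun D (fun t : R => (expR (- (k * t)) * (1 - expR (- t)) ^+ n)%:E).
Proof.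
apply/measurable_EFinP; apply: measurable_funM.
  exact: measurable_expRN_scale.
apply: measurable_funX; apply: measurable_funB => //.
exact: measurableT_comp.
Qed.

Lemma expRN_onem_ge0 k n t : t \in `]0, +oo[%R ->
  (0 <= (expR (- (k * t)) * (1 - expR (- t)) ^+ n)%:E)%E.
Proof.
rewrite in_itv/= andbT => t0; rewrite lee_fin mulr_ge0 ?expR_ge0// exprn_ge0//.
by rewrite subr_ge0 expR_le1 oppr_le0 ltW.
Qed.

(** Writing I(k, n) for the integral, exp(-t) + (1 - exp(-t)) = 1 gives
    I(k, n) = I(k, n + 1) + I(k + 1, n), which determines I(_, n + 1) from
    I(_, n). *)
Lemma integral_expRN_onem k n : 0 < k ->
  (\int[mu]_(t in `]0%R, +oo[) (expR (- (k * t)) * (1 - expR (- t)) ^+ n)%:E =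
  (n`!%:R / \prod_(i < n.+1) (k + i%:R))%:E)%E.
Proof.
elim: n k => [|n IHn] k k0.
  under eq_integral do rewrite expr0 mulr1.
  by rewrite integral_expRN// big_ord1 addr0 mul1r.
have := IHn _ k0.
under eq_integral => t _.
  have -> : expR (- (k * t)) * (1 - expR (- t)) ^+ n =
    expR (- (k * t)) * (1 - expR (- t)) ^+ n.+1 +
    expR (- ((k + 1) * t)) * (1 - expR (- t)) ^+ n.
    by rewrite mulrDl mul1r opprD expRD exprS; ring.
  rewrite EFinD; over.
rewrite ge0_integralD//=; [|exact: expRN_onem_ge0|exact: measurable_expRN_onem
  |exact: expRN_onem_ge0|exact: measurable_expRN_onem].
rewrite IHn ?ltr_wpDr//.
move=> /(congr1 (fun z =>
  z - (n`!%:R / \prod_(i < n.+1) (k + 1 + i%:R))%:E)%E).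
rewrite addeK// => ->; rewrite -EFinB; congr EFin.
rewrite !(prod_rising_recl _ k) big_ord_recr/= factS natrM -natr1.
have Q0 : \prod_(i < n) (k + 1 + i%:R) != 0.
  by rewrite gt_eqF// prod_rising_gt0// ltr_wpDr.
by field; rewrite Q0 !gt_eqF// ?ltr_wpDr.
Qed.

(** * Reduction of the mixture *)

Lemma gnb_be_pmf_beta_integral (m k : R) x : 0 < m -> m < k ->
  gnb_be_pmf m 1 1 (k - m) 1 x =
  (((k - m) * \prod_(i < x) (m + i%:R) / x`!%:R)%:E *
   \int[mu]_(t in `]0%R, +oo[) (expR (- (k * t)) * (1 - expR (- t)) ^+ x)%:E)%E.
Proof.
move=> m0 mk; have km0 : 0 < k - m by rewrite subr_gt0.
rewrite -ge0_integralZl_EFin//; first last.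
- by rewrite divr_ge0// mulr_ge0 ?ltW ?prod_rising_gt0.
- exact: measurable_expRN_onem.
- by move=> t; exact: expRN_onem_ge0.
apply: eq_integral => t _; rewrite -EFinM; congr EFin.
rewrite /gnb_pmf /be_pdf Beta1// subrr powRr0 !mul1r !mulr1 invrK.
rewrite gbinom_rising// addrK -expRM.
have -> : expR (- (k * t)) = expR (- t * m) * expR (- ((k - m) * t)).
  by rewrite -expRD; congr expR; ring.
by ring.
Qed.

End gamma_and_beta_integrals.

Theorem mainTheorem3 (R : realType) (m k : R) (hm : 0 < m) (hk : m < k)
    (x : nat) :
  gnb_be_pmf m 1 1 (k - m) 1 x = (waring_pmf m k x)%:E.
Proof.
have k0 : 0 < k by exact: lt_trans hk.
rewrite gnb_be_pmf_beta_integral// integral_expRN_onem// -EFinM; congr EFin.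
rewrite /waring_pmf -addrA natr1 !Gamma_addn//; field.
by rewrite pnatr_eq0 -lt0n fact_gt0 !gt_eqF// ?Gamma_gt0 ?prod_rising_gt0.
Qed.
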